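(* Let $P=\{x\in\mathbb{R}^n : Ax=b,\ Dx\le d\}$ be a $0/1$ polytope of dimension $\dim P$, and consider the linear program $\max\{c^\top x : x\in P\}$, where $A,D,b,d,c$ are integral. Starting from any feasible basis, the Simplex method with the Ordered Shadow pivot rule reaches an optimal solution by performing no more than $\dim P$ non-degenerate pivots.
   Context: A $0/1$ polytope is a polytope all of whose extreme points lie in $\{0,1\}^n$. It is assumed that $A$ has full row rank and that the inequalities $x\ge 0$ are among $Dx\le d$. Standard equality form. Adding one slack variable for each inequality of $Dx\le d$ other than the non-negativity constraints gives $\max\{c'^\top x : A'x=b',\ x\ge 0,\ x\in\mathbb{R}^{n'}\}$, with $A'$ of full row rank $m'$ (and $c'$ equal to $c$ extended by zeros). A basis is an ordered set $B=(B(1),\dots,B(m'))$ of column indices with $A'_B$ invertible; $N=[n']\setminus B$. Its basic solution is $x'(B)=A_B'^{-1}b'$, $x'(N)=0$; $B$ is feasible if $x'\ge 0$. The vertex $x$ of $P$ associated to $B$ is obtained from $x'$ by deleting the slack coordinates. Pivot directions and basic cone. For $j\in N$ the pivot direction is $z'^j\in\mathbb{R}^{n'}$ with $z'^j(B)=-A_B'^{-1}A'_j$, $z'^j(j)=1$, $z'^j(i)=0$ for $i\in N\setminus\{j\}$; let $z^j\in\mathbb{R}^n$ be its restriction to the original variables (also called a pivot direction at $B$). The basic cone is $\mathcal{C}(B)=\{z\in\mathbb{R}^n : Az=0,\ D^Bz\le 0\}$, where $D^B$ consists of the rows of $D$ for the constraints $x(j)\ge 0$ with $j\in N$ an original variable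 and for the inequalities whose slack variable is nonbasic. The vectors $z^j$, $j\in N$, generate the extreme rays of $\mathcal{C}(B)$, and $c^\top z^j$ is the reduced cost of $j$. Pivots. At a feasible basis $B$, a pivot with entering index $j\in N$ puts $u=A_B'^{-1}A'_j$, chooses a leaving position $\ell$ attaining $\min_{i:u(i)>0} x'(B(i))/u(i)$, and replaces $B(\ell)$ by $j$. It is non-degenerate if $x'+\varepsilon z'^j$ is feasible for some $\varepsilon>0$ (then the vertex changes to an adjacent one), and degenerate otherwise (then the vertex does not change). The Simplex method stops when $c^\top z^j\le 0$ for all $j\in N$. Ordered Shadow pivot rule. Let $x^0$ be the vertex of $P$ associated to the starting basis, let $c^*=\|c\|_1+2$, and define $v\in\mathbb{R}^n$ by $v(k)=(-1)^{x^0(k)}(c^* )^k$ for $k=1,\dots,n$; $v$ stays fixed during the whole run. Phase 1: if the starting basis does not satisfy the condition ( * ) for each $z\in\mathcal{C}(B)$, if $c^\top z>0$ then $v^\top z>0$, perform a sequence of degenerate pivots (staying at $x^0$) leading to a basis satisfying ( * ). Phase 2: from then on, at each non-optimal basis $B$ select as pivot direction a $z^j$ maximizing $\frac{c^\top z^j}{v^\top z^j}$ among the pivot directions at $B$ with $c^\top z^j>0$. Ties for the leaving variable are broken lexicographically: fix an ordering of the columns of $A'$ in which the columns of the basis at the start of Phase 2 come first, and choose $\ell$ among $\{i:u(i)>0\}$ so that $\frac{1}{u(\ell)}$ times the $\ell$-th row of $A_B'^{-1}[\,b'\mid A'\,]$ (columns of $A'$ in the fixed order) is lexicographically smallest. 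*)

(* Defs.v *)
From mathcomp Require Import all_boot all_order all_fingroup all_algebra.
From mathcomp Require Import boolp classical_sets.

Set Implicit Arguments.
Unset Strict Implicit.
Unset Printing Implicit Defensive.

Import Order.TTheory GRing.Theory Num.Theory.
Local Open Scope ring_scope.

Section Polyhedra.
Variables (R : realFieldType) (n : nat).
Implicit Types (x y z : 'cV[R]_n) (S : set 'cV[R]_n).

Definition dot x y : R := (x^T *m y) 0 0.

Definition extreme_point S x : Prop :=
  S x /\ forall y z (t : R), S y -> S z -> 0 < t < 1 ->
           x = t *: y + (1 - t) *: z -> y = x /\ z = x.

Definition bounded S : Prop :=
  exists M : R, forall x, S x -> forall k, `|x k 0| <= M.

(* For a polyhedron [S]: bounded (a polytope) with all extreme points 0/1. *)
Definition zero_one_polytope S : Prop :=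
  bounded S /\
  forall x, extreme_point S x -> forall k, x k 0 = 0 \/ x k 0 = 1.

Definition affinely_independent k (p : 'I_k.+1 -> 'cV[R]_n) : bool :=
  row_free (\matrix_(i < k) (p (lift ord0 i) - p ord0)^T).

(* The largest k such that S contains k+1 affinely
   independent points (0 by convention when S is empty). *)
Definition affine_dim S : nat :=
  (\max_(k < n.+1 | `[< exists p : 'I_k.+1 -> 'cV[R]_n,
      affinely_independent p /\ forall i, S (p i) >]) k)%N.

End Polyhedra.

(* max { c^T x : A x = b, D x <= d }. *)
Record linprog (R : realFieldType) (m n q : nat) := LinProg {
  lpA : 'M[R]_(m, n); lpb : 'cV[R]_m;
  lpD : 'M[R]_(q, n); lpd : 'cV[R]_q;
  lpc : 'cV[R]_n
}.

Section LinearPrograms.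
Variables (R : realFieldType) (m n q : nat).
Implicit Type L : linprog R m n q.

Definition integral_mx r s (M : 'M[R]_(r, s)) : Prop :=
  exists N : 'M[int]_(r, s), M = map_mx intr N.

Definition integral L : Prop :=
  [/\ integral_mx (lpA L), integral_mx (lpb L), integral_mx (lpD L),
      integral_mx (lpd L) & integral_mx (lpc L)].

Definition polyhedron L : set 'cV[R]_n :=
  fun x => lpA L *m x = lpb L /\
           forall i, (lpD L *m x) i 0 <= lpd L i 0.

Definition optimal_solution L (x : 'cV[R]_n) : Prop :=
  polyhedron L x /\
  forall y, polyhedron L y -> dot (lpc L) y <= dot (lpc L) x.

(* Row i of D x <= d is the constraint - x_k <= 0. *)
Definition nonneg_row L (i : 'I_q) (k : 'I_n) : bool :=
  (row i (lpD L) == - delta_mx 0 k) && (lpd L i 0 == 0).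

Definition has_nonneg_rows L : Prop :=
  forall k : 'I_n, exists i : 'I_q, nonneg_row L i k.

Definition slack_rows L : {set 'I_q} :=
  [set i | ~~ [exists k, nonneg_row L i k]].

Definition nslack L : nat := #|slack_rows L|.
Definition nrows L : nat := (m + nslack L)%N.
Definition ncols L : nat := (n + nslack L)%N.

Definition slackD L : 'M[R]_(nslack L, n) :=
  rowsub (fun i => enum_val i) (lpD L).
Definition slackd L : 'cV[R]_(nslack L) :=
  rowsub (fun i => enum_val i) (lpd L).

(* Standard equality form: the original variables come first, and the slack
   variable of the i-th row of [slackD L] is column [rshift n i]. *)
Definition stdA L : 'M[R]_(nrows L, ncols L) :=
  block_mx (lpA L) 0 (slackD L) 1%:M.
Definition stdb L : 'cV[R]_(nrows L) := col_mx (lpb L) (slackd L).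

Definition std_feasible L (x : 'cV[R]_(ncols L)) : Prop :=
  stdA L *m x = stdb L /\ forall k, 0 <= x k 0.

Definition original L (x : 'cV[R]_(ncols L)) : 'cV[R]_n := usubmx x.

End LinearPrograms.

(* Ordered lists B(1), ..., B(m') of column indices. *)
Notation basis L := {ffun 'I_(nrows L) -> 'I_(ncols L)}.

Section Simplex.
Variables (R : realFieldType) (m n q : nat) (L : linprog R m n q).
Implicit Types (B : basis L) (j : 'I_(ncols L)) (l : 'I_(nrows L)).

Definition basis_mx B : 'M[R]_(nrows L) := colsub B (stdA L).

(* Invertibility of the basis matrix forces B to be injective. *)
Definition is_basis B : Prop := basis_mx B \in unitmx.

Definition basic B j : bool := j \in codom B.

(* The vector whose B-coordinates are w and whose other coordinates are 0
   (for B injective, each sum has at most one term). *)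
Definition embed B (w : 'cV[R]_(nrows L)) : 'cV[R]_(ncols L) :=
  \col_k \sum_(i | B i == k) w i 0.

Definition basic_coords B : 'cV[R]_(nrows L) :=
  invmx (basis_mx B) *m stdb L.

Definition basic_solution B : 'cV[R]_(ncols L) := embed B (basic_coords B).

Definition feasible_basis B : Prop :=
  is_basis B /\ forall k, 0 <= basic_solution B k 0.

Definition vertex B : 'cV[R]_n := original (basic_solution B).

Definition tableau_col B j : 'cV[R]_(nrows L) :=
  invmx (basis_mx B) *m col j (stdA L).

Definition std_direction B j : 'cV[R]_(ncols L) :=
  delta_mx j 0 - embed B (tableau_col B j).

Definition pivot_direction B j : 'cV[R]_n := original (std_direction B j).

Definition basic_cone B : set 'cV[R]_n := fun z =>
  [/\ lpA L *m z = 0,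
      forall k : 'I_n, ~~ basic B (lshift (nslack L) k) -> 0 <= z k 0
    & forall i : 'I_(nslack L), ~~ basic B (rshift n i) ->
        (slackD L *m z) i 0 <= 0].

Definition reduced_cost B j : R := dot (lpc L) (pivot_direction B j).

Definition stops B : Prop := forall j, ~~ basic B j -> reduced_cost B j <= 0.

Definition leaving_ratio B j i : R := basic_coords B i 0 / tableau_col B j i 0.

Definition pivot B j l : Prop :=
  [/\ ~~ basic B j, 0 < tableau_col B j l 0
    & forall i, 0 < tableau_col B j i 0 ->
        leaving_ratio B j l <= leaving_ratio B j i].

Definition exchange B j l : basis L :=
  [ffun i => if i == l then j else B i].

Definition nondegenerate B j : Prop :=
  exists2 e : R, 0 < e
    & std_feasible (basic_solution B + e *: std_direction B j).

Inductive degenerate_pivots (B0 : basis L) : basis L -> Prop :=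
| degenerate_nil : degenerate_pivots B0 B0
| degenerate_step B j l :
    degenerate_pivots B0 B -> pivot B j l -> ~ nondegenerate B j ->
    degenerate_pivots B0 (exchange B j l).

(* Row i of A'_B^-1 [b' | A'] divided by the i-th entry of the entering
   column; position p of the column ordering holds column s p of A'. *)
Definition lex_row (s : 'S_(ncols L)) B j i : (1 + ncols L)%N.-tuple R :=
  [tuple (tableau_col B j i 0)^-1 *
     (invmx (basis_mx B) *m row_mx (stdb L) (col_perm s (stdA L))) i p
   | p < (1 + ncols L)%N].

Definition lex_leaving (s : 'S_(ncols L)) B j l : Prop :=
  forall i, 0 < tableau_col B j i 0 ->
    ((lex_row s B j l : (1 + ncols L)%N.-tuplelexi R) <= lex_row s B j i)%O.

Definition basis_first (s : 'S_(ncols L)) B : Prop :=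
  forall p : 'I_(ncols L), (p < nrows L)%N -> basic B (s p).

End Simplex.

Section OrderedShadow.
Variables (R : realFieldType) (m n q : nat) (L : linprog R m n q).

Definition cstar : R := (\sum_(k < n) `|lpc L k 0|) + 2.

(* [x0] is a 0/1 vector, so [x0 k 0 == 1] (a boolean, read as 0 or 1) is the
   exponent x0(k); coordinates are numbered from 0, hence the power k.+1. *)
Definition shadow_vector (x0 : 'cV[R]_n) : 'cV[R]_n :=
  \col_k ((-1) ^+ (x0 k 0 == 1) * cstar ^+ k.+1).

Variable v : 'cV[R]_n.

Definition cone_condition (B : basis L) : Prop :=
  forall z, basic_cone B z -> 0 < dot (lpc L) z -> 0 < dot v z.

Definition phase1 (B0 B1 : basis L) : Prop :=
  (cone_condition B0 /\ B1 = B0) \/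
  [/\ ~ cone_condition B0, degenerate_pivots B0 B1 & cone_condition B1].

Definition slope (B : basis L) j : R :=
  reduced_cost B j / dot v (pivot_direction B j).

Definition improving (B : basis L) j : Prop :=
  ~~ basic B j /\ 0 < reduced_cost B j.

(* Division by 0 yields 0 here; the selection is only regarded as meaningful
   when every slope being compared has a nonzero denominator. *)
Definition shadow_entering (B : basis L) j : Prop :=
  improving B j /\
  forall i, improving B i ->
    dot v (pivot_direction B i) != 0 /\ slope B i <= slope B j.

Variable s : 'S_(ncols L).

Definition shadow_pivot (B : basis L) j l : Prop :=
  [/\ shadow_entering B j, pivot B j l & lex_leaving s B j l].

Definition shadow_step (B B' : basis L) : Prop :=
  exists j l, shadow_pivot B j l /\ B' = exchange B j l.

(* [phase2 B1 k B]: some finite run of Phase 2 goes from B1 to B and contains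
   exactly k non-degenerate pivots. *)
Inductive phase2 (B1 : basis L) : nat -> basis L -> Prop :=
| phase2_start : phase2 B1 0 B1
| phase2_degenerate k B j l :
    phase2 B1 k B -> shadow_pivot B j l -> ~ nondegenerate B j ->
    phase2 B1 k (exchange B j l)
| phase2_nondegenerate k B j l :
    phase2 B1 k B -> shadow_pivot B j l -> nondegenerate B j ->
    phase2 B1 k.+1 (exchange B j l).

End OrderedShadow.

(* Main.v *)
(** Write [v] for the shadow vector and [C] for [c*].  Every basis met in
    Phase 2 is dual feasible for an objective [c - lam v] with [lam >= 0], which
    implies the cone condition: the maximal slope of the entering directions is
    such a [lam], and since the entering direction has reduced cost 0 for
    [c - lam v], the exchanged basis remains dual feasible.  Hence slopes never
    increase.  A non-degenerate move [d] between 0/1 points has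
    [1 <= c d <= C - 2], while [v d] is [C^H] up to an error of at most
    [C + ... + C^(H-1)], where [H] is the last coordinate that changes, and
    coordinate [H] leaves its value in [x0].  So a larger slope means a smaller
    [H], the leading coordinates strictly increase along the run, and the
    visited vertices are affinely independent.

    Phase 1 is the lexicographic simplex method applied to [c - v]: the start
    vertex is the best 0/1 point for that objective, so all pivots are
    degenerate.  Both phases terminate because the objective row of the tableau
    increases lexicographically at each pivot with positive reduced cost. *)

Require Import Defs.
From mathcomp Require Import all_boot all_order all_fingroup all_algebra.
From mathcomp Require Import boolp classical_sets.
From mathcomp Require Import ring lra.

Set Implicit Arguments.
Unset Strict Implicit.
Unset Printing Implicit Defensive.

Import Order.TTheory GRing.Theory Num.Theory.
Local Open Scope ring_scope.

(** * Basic solutions and pivot directions *)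

Lemma sub_mxE (V : zmodType) p r (A C : 'M[V]_(p, r)) i j :
  (A - C) i j = A i j - C i j.
Proof. by rewrite !mxE. Qed.

Section Dot.
Variables (R : realFieldType) (n : nat).
Implicit Types (x y z : 'cV[R]_n) (a : R).

Lemma dotE x y : dot x y = \sum_k x k 0 * y k 0.
Proof. by rewrite /dot mxE; apply: eq_bigr => k _; rewrite mxE. Qed.

Lemma dotDr x y z : dot x (y + z) = dot x y + dot x z.
Proof. by rewrite /dot mulmxDr mxE. Qed.

Lemma dotZr a x y : dot x (a *: y) = a * dot x y.
Proof. by rewrite /dot -scalemxAr mxE. Qed.

Lemma dotNr x y : dot x (- y) = - dot x y.
Proof. by rewrite /dot mulmxN mxE. Qed.

Lemma dotBr x y z : dot x (y - z) = dot x y - dot x z.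
Proof. by rewrite dotDr dotNr. Qed.

Lemma dot0r x : dot x 0 = 0.
Proof. by rewrite /dot mulmx0 mxE. Qed.

Lemma dot_sumr x I (r : seq I) (P : pred I) (F : I -> 'cV[R]_n) :
  dot x (\sum_(i <- r | P i) F i) = \sum_(i <- r | P i) dot x (F i).
Proof. by rewrite /dot mulmx_sumr summxE. Qed.

Lemma dotBZl x y z a : dot (x - a *: y) z = dot x z - a * dot y z.
Proof.
by rewrite !dotE mulr_sumr -sumrB; apply: eq_bigr => k _; rewrite !mxE; ring.
Qed.

End Dot.

Section Bases.
Variables (R : realFieldType) (m n q : nat) (L : linprog R m n q).
Implicit Types (B : basis L) (j k : 'I_(ncols L)) (l i : 'I_(nrows L)).
Implicit Types (x z : 'cV[R]_n) (y : 'cV[R]_(ncols L)).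

(** The slacks are forced by the original variables. [h] is [slackd L] for points and 0 for
    directions. *)
Definition extend (h : 'cV[R]_(nslack L)) x : 'cV[R]_(ncols L) :=
  col_mx x (h - slackD L *m x).

Lemma original_extend h x : original (extend h x) = x.
Proof. exact: col_mxKu. Qed.

Lemma stdA_extend h x : stdA L *m extend h x = col_mx (lpA L *m x) h.
Proof. by rewrite mul_block_col mul0mx addr0 mul1mx addrC subrK. Qed.

Lemma extend_original (g : 'cV[R]_m) h y :
  stdA L *m y = col_mx g h ->
  lpA L *m original y = g /\ y = extend h (original y).
Proof.
rewrite /original -{1}[y]vsubmxK mul_block_col mul0mx addr0 mul1mx.
move=> /eq_col_mx[-> <-]; split=> //.
by rewrite /extend addrC addKr vsubmxK.
Qed.

Lemma stdA_kernel y : stdA L *m y = 0 ->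
  lpA L *m original y = 0 /\ y = extend 0 (original y).
Proof. by rewrite -col_mx0 => /extend_original. Qed.

Lemma nonneg_rowE (r : 'I_q) (k : 'I_n) x : nonneg_row L r k ->
  ((lpD L *m x) r 0 <= lpd L r 0) = (0 <= x k 0).
Proof.
move=> /andP[/eqP Dr /eqP ->].
have -> : (lpD L *m x) r 0 = (row r (lpD L) *m x) 0 0 by rewrite -row_mul !mxE.
rewrite Dr mulNmx -rowE !mxE; exact: oppr_le0.
Qed.

Lemma slackD_row (r : 'I_q) (rs : r \in slack_rows L) x :
  let t := enum_rank_in rs r in
  (slackD L *m x) t 0 = (lpD L *m x) r 0 /\ slackd L t 0 = lpd L r 0.
Proof.
have er : enum_val (enum_rank_in rs r) = r by rewrite enum_rankK_in.
split; last by rewrite mxE er.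
by rewrite !mxE; apply: eq_bigr => k _; rewrite mxE er.
Qed.

Lemma slackD_enum (t : 'I_(nslack L)) x :
  (slackD L *m x) t 0 = (lpD L *m x) (enum_val t) 0.
Proof. by rewrite !mxE; apply: eq_bigr => k _; rewrite mxE. Qed.

Lemma polyhedron_original y : std_feasible y -> polyhedron L (original y).
Proof.
move=> [Ay y0]; have [Ao ye] := extend_original Ay; split=> // r.
have [/existsP[k rk]|rs] := boolP [exists k, nonneg_row L r k].
  by rewrite (nonneg_rowE _ rk) mxE; apply: y0.
have rsl : r \in slack_rows L by rewrite inE.
have [<- <-] := slackD_row rsl (original y).
have := y0 (rshift n (enum_rank_in rsl r)).
by rewrite {1}ye /extend col_mxEd sub_mxE subr_ge0.
Qed.

Lemma std_feasible_extend x : has_nonneg_rows L -> polyhedron L x ->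
  std_feasible (extend (slackd L) x).
Proof.
move=> Dn [Ax Dx]; split=> [|k]; first by rewrite stdA_extend Ax.
rewrite /extend; case: (split_ordP k) => t ->.
  have [r rt] := Dn t; by rewrite col_mxEu -(nonneg_rowE _ rt).
rewrite col_mxEd sub_mxE slackD_enum subr_ge0.
by apply: le_trans (Dx _) _; rewrite mxE.
Qed.

Lemma col_basis_mx B i : col i (basis_mx B) = col (B i) (stdA L).
Proof. by apply/colP => r; rewrite !mxE. Qed.

(** A repeated index would put a difference of two unit vectors in the kernel of an invertible
    matrix. *)
Lemma basis_inj B : is_basis B -> injective B.
Proof.
move=> Bb i i' eB; apply/eqP/contraT => ii'.
have : basis_mx B *m (delta_mx i 0 - delta_mx i' 0 : 'cV_ _) = 0.
  by rewrite mulmxBr -!colE !col_basis_mx eB subrr.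
move=> /(congr1 (mulmx (invmx (basis_mx B)))); rewrite mulKmx // mulmx0.
move=> /colP/(_ i); rewrite !mxE eqxx (negPf ii') subr0 => /eqP.
by rewrite oner_eq0.
Qed.

Lemma embed_basic B w i : is_basis B -> embed B w (B i) 0 = w i 0.
Proof.
move=> Bb; rewrite mxE (bigD1 i) //= big1 ?addr0 // => i' /andP[/eqP eB].
by rewrite (basis_inj Bb eB) eqxx.
Qed.

Lemma basicP B k : reflect (exists i, k = B i) (basic B k).
Proof. exact: codomP. Qed.

Lemma basic_basis B i : basic B (B i).
Proof. exact: codom_f. Qed.

Lemma embed_nonbasic B w k : ~~ basic B k -> embed B w k 0 = 0.
Proof.
move=> Bk; rewrite mxE big1 // => i /eqP eB; case/negP: Bk.
by rewrite -eB basic_basis.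
Qed.

Lemma stdA_embed B w : stdA L *m embed B w = basis_mx B *m w.
Proof.
apply/colP => r; rewrite mxE [RHS]mxE [RHS](partition_big B predT) //=.
apply: eq_bigr => k _; rewrite [embed _ _ _ _]mxE mulr_sumr;
  apply: eq_bigr => i /eqP <-.
by rewrite [basis_mx _ _ _]mxE.
Qed.

Lemma eq_embed B y : is_basis B -> (forall k, ~~ basic B k -> y k 0 = 0) ->
  y = embed B (\col_i y (B i) 0).
Proof.
move=> Bb yN; apply/colP => k; have [/basicP[i ->]|Bk] := boolP (basic B k).
  by rewrite embed_basic // [RHS]mxE.
by rewrite embed_nonbasic // yN.
Qed.

Lemma nonbasic_eq0 B y : is_basis B -> stdA L *m y = 0 ->
  (forall k, ~~ basic B k -> y k 0 = 0) -> y = 0.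
Proof.
move=> Bb Ay yN; have := Ay; rewrite (eq_embed Bb yN) stdA_embed.
move=> /(congr1 (mulmx (invmx (basis_mx B)))); rewrite mulKmx // mulmx0 => ->.
by apply/colP => k; rewrite !mxE big1 // => i _; rewrite mxE.
Qed.

Lemma basis_mx_tableau B j : is_basis B ->
  basis_mx B *m tableau_col B j = col j (stdA L).
Proof. by move=> Bb; rewrite mulKVmx. Qed.

Lemma stdA_direction B j : is_basis B -> stdA L *m std_direction B j = 0.
Proof.
by move=> Bb; rewrite mulmxBr stdA_embed basis_mx_tableau // -colE subrr.
Qed.

Lemma direction_nonbasic B j k : ~~ basic B k ->
  std_direction B j k 0 = (k == j)%:R.
Proof. by move=> Bk; rewrite sub_mxE embed_nonbasic // subr0 mxE andbT. Qed.

Lemma direction_basic B j i : is_basis B -> ~~ basic B j ->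
  std_direction B j (B i) 0 = - tableau_col B j i 0.
Proof.
move=> Bb Bj; rewrite sub_mxE embed_basic // mxE andbT.
by case: eqP Bj => [<-|_ _]; rewrite ?basic_basis // add0r.
Qed.

(** Both sides lie in the kernel of [stdA L] and agree on the nonbasic coordinates, which determine
    a kernel vector. *)
Lemma kernel_decomposition B y : is_basis B -> stdA L *m y = 0 ->
  y = \sum_(j | ~~ basic B j) y j 0 *: std_direction B j.
Proof.
move=> Bb Ay; apply/eqP; rewrite -subr_eq0; apply/eqP; apply: (nonbasic_eq0 Bb).
  rewrite mulmxBr Ay mulmx_sumr big1 ?subr0 // => j _.
  by rewrite -scalemxAr stdA_direction // scaler0.
move=> k Bk; rewrite sub_mxE summxE (bigD1 k) //= big1 => [|j /andP[_ jk]].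
  by rewrite mxE direction_nonbasic // eqxx mulr1 addr0 subrr.
by rewrite mxE direction_nonbasic // eq_sym (negPf jk) mulr0.
Qed.

Lemma original_sum I (r : seq I) (P : pred I) (F : I -> 'cV[R]_(ncols L)) :
  original (\sum_(i <- r | P i) F i) = \sum_(i <- r | P i) original (F i).
Proof. exact: linear_sum. Qed.

Lemma originalZ (a : R) y : original (a *: y) = a *: original y.
Proof. exact: linearZ. Qed.

Lemma originalD y1 y2 : original (y1 + y2) = original y1 + original y2.
Proof. exact: linearD. Qed.

Lemma originalB y1 y2 : original (y1 - y2) = original y1 - original y2.
Proof. exact: linearB. Qed.

Lemma dot_kernel B (w : 'cV[R]_n) y : is_basis B -> stdA L *m y = 0 ->
  dot w (original y) =
  \sum_(j | ~~ basic B j) y j 0 * dot w (pivot_direction B j).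
Proof.
move=> Bb Ay; rewrite {1}(kernel_decomposition Bb Ay) original_sum dot_sumr.
by apply: eq_bigr => j _; rewrite originalZ dotZr.
Qed.

Lemma stdA_basic_solution B : is_basis B -> stdA L *m basic_solution B = stdb L.
Proof. by move=> Bb; rewrite stdA_embed mulKVmx. Qed.

Lemma eq_basic_solution B y : is_basis B -> stdA L *m y = stdb L ->
  (forall k, ~~ basic B k -> y k 0 = 0) -> basic_solution B = y.
Proof.
move=> Bb Ay yN; apply/eqP; rewrite -subr_eq0; apply/eqP.
apply: (nonbasic_eq0 Bb);
  first by rewrite mulmxBr stdA_basic_solution // Ay subrr.
by move=> k Bk; rewrite sub_mxE yN // embed_nonbasic // subr0.
Qed.

Lemma std_feasible_basic B :
  feasible_basis B -> std_feasible (basic_solution B).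
Proof. by case=> Bb B0; split=> //; rewrite stdA_basic_solution. Qed.

Lemma polyhedron_vertex B : feasible_basis B -> polyhedron L (vertex B).
Proof. by move=> /std_feasible_basic/polyhedron_original. Qed.

(** The nonbasic coordinates of a basic solution are 0, so they vanish at both ends of any feasible
    segment through it; the basic solution is the only solution with this property. *)
Lemma extreme_vertex B : has_nonneg_rows L -> feasible_basis B ->
  extreme_point (polyhedron L) (vertex B).
Proof.
move=> Dn Bf; have [Bb _] := Bf; split; first exact: polyhedron_vertex.
move=> y z t Py Pz /andP[t0 t1] xyz.
have [Ay y0] := std_feasible_extend Dn Py.
have [Az z0] := std_feasible_extend Dn Pz.
(* Adding slacks is an affine map, so the convex combination lifts to the equality form. *)
have ext : basic_solution B =
    t *: extend (slackd L) y + (1 - t) *: extend (slackd L) z.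
  have [_ ->] := extend_original (stdA_basic_solution Bb).
  rewrite -/(vertex B) xyz /extend !scale_col_mx add_col_mx; congr col_mx.
  rewrite mulmxDr -!scalemxAr; apply/colP => r; rewrite !mxE; ring.
have N0 k : ~~ basic B k ->
    extend (slackd L) y k 0 = 0 /\ extend (slackd L) z k 0 = 0.
  move=> Bk; have /colP/(_ k) := ext.
  rewrite embed_nonbasic // [RHS]mxE [X in _ = X + _]mxE [X in _ = _ + X]mxE.
  move: (y0 k) (z0 k); move: (extend _ y k 0) (extend _ z k 0) => a b a0 b0 e.
  move/esym/eqP: e; rewrite paddr_eq0 ?mulr_ge0 ?(ltW t0) ?subr_ge0 ?(ltW t1) //.
  by rewrite !mulf_eq0 subr_eq0 (gt_eqF t0) (gt_eqF t1) /= => /andP[/eqP-> /eqP->].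
have eo u : stdA L *m extend (slackd L) u = stdb L ->
    (forall k, ~~ basic B k -> extend (slackd L) u k 0 = 0) -> u = vertex B.
  by move=> Au uN; rewrite /vertex (eq_basic_solution Bb Au uN) original_extend.
by split; apply: eo => // k /N0[].
Qed.

End Bases.

(** * Pivots and the lexicographic rule *)

Section LexicographicSigns.
Variables (R : realFieldType) (p : nat).
Implicit Types r : 'rV[R]_p.

Definition lexpos r : Prop :=
  exists2 k, 0 < r 0 k & forall k' : 'I_p, (k' < k)%N -> r 0 k' = 0.

Lemma lexpos_neq0 r : lexpos r -> r != 0.
Proof. by case=> k rk _; apply: contraTneq rk => ->; rewrite mxE ltxx. Qed.

Lemma lexposZ a r : 0 < a -> lexpos r -> lexpos (a *: r).
Proof.
move=> a0 [k rk r0]; exists k => [|k' k'k]; first by rewrite mxE mulr_gt0.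
by rewrite mxE r0 // mulr0.
Qed.

Lemma lexposD r1 r2 : lexpos r1 -> lexpos r2 -> lexpos (r1 + r2).
Proof.
move=> [k1 r1k r10] [k2 r2k r20]; case: (ltngtP k1 k2) => [k12|k21|k12].
- exists k1 => [|k' k'k]; rewrite mxE; first by rewrite [r2 _ _]r20 // addr0.
  by rewrite r10 // r20 ?addr0 // (ltn_trans k'k).
- exists k2 => [|k' k'k]; rewrite mxE; first by rewrite [r1 _ _]r10 // add0r.
  by rewrite r10 ?r20 ?addr0 // (ltn_trans k'k).
- move/ord_inj: k12 r2k r20 => <- r2k r20; exists k1 => [|k' k'k]; rewrite mxE.
    by rewrite addr_gt0.
  by rewrite r10 // r20 // addr0.
Qed.

Lemma tuplelexi_le (t1 t2 : p.-tuplelexi R) : (t1 <= t2)%O ->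
  \row_k (tnth t2 k - tnth t1 k) = 0 \/ lexpos (\row_k (tnth t2 k - tnth t1 k)).
Proof.
rewrite le_eqVlt => /orP[/eqP ->|/ltxi_tuplePlt[k tk lt12]].
  by left; apply/rowP => k; rewrite !mxE subrr.
right; exists k => [|k' k'k]; first by rewrite mxE subr_gt0.
by rewrite mxE tk // subrr.
Qed.

End LexicographicSigns.

Lemma row_coefE (V : Type) p r (A : 'M[V]_(p, r)) i c k : row i A c k = A i k.
Proof. by rewrite mxE. Qed.

Section Pivots.
Variables (R : realFieldType) (m n q : nat) (L : linprog R m n q).
Implicit Types (B : basis L) (j k : 'I_(ncols L)) (l i : 'I_(nrows L)).
Implicit Types (x z w : 'cV[R]_n) (y : 'cV[R]_(ncols L)) (s : 'S_(ncols L)).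

Lemma nonbasic_exchange B j l k : ~~ basic (exchange B j l) k ->
  k != j /\ (k = B l \/ ~~ basic B k).
Proof.
move=> Nk; split.
  by apply: contraNneq Nk => ->; apply/basicP; exists l; rewrite ffunE eqxx.
case: (boolP (basic B k)) => [/basicP[i ki]|]; last by right.
left; rewrite ki; congr (B _); apply: contraNeq Nk => il.
by apply/basicP; exists i; rewrite ffunE (negPf il).
Qed.

Lemma exchange_nonbasic B j l k : ~~ basic B k -> k != j ->
  ~~ basic (exchange B j l) k.
Proof.
move=> Nk kj; apply/basicP => -[i]; rewrite ffunE.
case: eqP => _ ki; first by rewrite ki eqxx in kj.
by rewrite ki basic_basis in Nk.
Qed.

(** The eta matrix of the product form of the inverse: the identity with column [l] replaced by the
    entering tableau column. *)
Definition eta B j l : 'M[R]_(nrows L) :=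
  1%:M + (tableau_col B j - delta_mx l 0) *m delta_mx 0 l.

Lemma mul_eta B j l p (X : 'M_(_, p)) i (k : 'I_p) :
  (eta B j l *m X) i k =
  X i k + (tableau_col B j i 0 - (i == l)%:R) * X l k.
Proof.
rewrite /eta mulmxDl mul1mx -mulmxA -rowE mxE; congr (_ + _).
by rewrite mxE big_ord1 sub_mxE !mxE andbT.
Qed.

Lemma basis_mx_exchange B j l : is_basis B ->
  basis_mx (exchange B j l) = basis_mx B *m eta B j l.
Proof.
move=> Bb; rewrite /eta mulmxDr mulmx1 mulmxA mulmxBr basis_mx_tableau //.
rewrite -colE; apply/matrixP => r i; rewrite 2!mxE ffunE [RHS]mxE.
rewrite [basis_mx _ _ _]mxE [(_ *m _) _ _]mxE big_ord1 sub_mxE !mxE /=.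
by case: eqP => [->|_]; rewrite ?mulr1 ?mulr0 ?addr0 // addrC subrK.
Qed.

Lemma eta_unit B j l : tableau_col B j l 0 != 0 -> eta B j l \in unitmx.
Proof.
(* The witness is the Sherman-Morrison inverse of this rank-one update, whose denominator is
   [tableau_col B j l 0]. *)
move=> ul; have [] // := @mulmx1_unit _ _ (eta B j l)
  (1%:M - (tableau_col B j l 0)^-1 *:
     ((tableau_col B j - delta_mx l 0) *m delta_mx 0 l)).
apply/matrixP => i k; rewrite mul_eta.
move: (tableau_col B j) ul => u ul; rewrite !mxE !big_ord1 !mxE !eqxx !andbT /=.
by rewrite (eq_sym k); case: (l == k) => /=; field.
Qed.

Lemma is_basis_exchange B j l : is_basis B -> tableau_col B j l 0 != 0 ->
  is_basis (exchange B j l).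
Proof.
by move=> Bb ul; rewrite /is_basis basis_mx_exchange // unitmx_mul Bb eta_unit.
Qed.

(** The old tableau is [eta] times the new one; this direction avoids inverting [eta]. *)
Lemma tableau_exchange B j l p (X : 'M_(_, p)) i (k : 'I_p) :
    is_basis B -> tableau_col B j l 0 != 0 ->
  let T' := invmx (basis_mx (exchange B j l)) *m X in
  (invmx (basis_mx B) *m X) i k =
  T' i k + (tableau_col B j i 0 - (i == l)%:R) * T' l k.
Proof.
move=> Bb ul T'; rewrite -mul_eta; congr (fun_of_matrix _ i k).
rewrite -[in LHS](mulKVmx (is_basis_exchange Bb ul) X) -/T'.
by rewrite basis_mx_exchange // -mulmxA mulKmx.
Qed.

(** By uniqueness of basic solutions, it suffices that the moved point vanishes off the new basis;
    the ratio is the step at which coordinate [B l] reaches 0. *)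
Lemma basic_solution_exchange B j l : is_basis B -> ~~ basic B j ->
    tableau_col B j l 0 != 0 ->
  basic_solution (exchange B j l) =
  basic_solution B + leaving_ratio B j l *: std_direction B j.
Proof.
move=> Bb Bj ul; apply: eq_basic_solution => [||k].
- exact: is_basis_exchange.
- rewrite mulmxDr -scalemxAr stdA_direction // scaler0 addr0.
  exact: stdA_basic_solution.
move=> /nonbasic_exchange[kj [->|Bk]]; rewrite mxE [X in _ + X]mxE.
  by rewrite direction_basic // embed_basic // mulrN divfK ?subrr.
by rewrite direction_nonbasic // embed_nonbasic // (negPf kj) mulr0 addr0.
Qed.

Lemma coords_ge0 B i : feasible_basis B -> 0 <= basic_coords B i 0.
Proof. by case=> Bb /(_ (B i)); rewrite embed_basic. Qed.

Lemma ratio_ge0 B j l : feasible_basis B -> pivot B j l ->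
  0 <= leaving_ratio B j l.
Proof. by move=> Bf [_ ul _]; rewrite divr_ge0 ?coords_ge0 // ltW. Qed.

Lemma feasible_exchange B j l : feasible_basis B -> pivot B j l ->
  feasible_basis (exchange B j l).
Proof.
move=> Bf Bp; have [Bj ul ratio] := Bp; have [Bb B0] := Bf.
have r0 := ratio_ge0 Bf Bp; split.
  by apply: is_basis_exchange; rewrite // gt_eqF.
move=> k; rewrite basic_solution_exchange ?gt_eqF // mxE [X in _ + X]mxE.
have [/basicP[i ->]|Bk] := boolP (basic B k).
  rewrite embed_basic // direction_basic // mulrN subr_ge0.
  have [u0|u0] := ltP 0 (tableau_col B j i 0).
    by rewrite -ler_pdivlMr // ratio.
  by apply: le_trans (coords_ge0 i Bf); rewrite mulr_ge0_le0.
rewrite embed_nonbasic // add0r direction_nonbasic //.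
by rewrite mulr_ge0 // ler0n.
Qed.

(** Nonnegativity of coordinate [B l] bounds every feasible step by the ratio, and the full step
    ends at a feasible basis. *)
Lemma nondegenerate_ratio B j l : feasible_basis B -> pivot B j l ->
  Defs.nondegenerate B j <-> 0 < leaving_ratio B j l.
Proof.
move=> Bf Bp; have [Bj ul ratio] := Bp; have [Bb B0] := Bf; split.
  move=> [e e0 [_ /(_ (B l))]]; rewrite mxE [X in _ + X]mxE.
  rewrite embed_basic // direction_basic // mulrN subr_ge0 -ler_pdivlMr //.
  exact: lt_le_trans.
move=> r0; exists (leaving_ratio B j l) => //.
rewrite -basic_solution_exchange ?gt_eqF //.
exact/std_feasible_basic/feasible_exchange.
Qed.

Lemma vertex_exchange B j l : feasible_basis B -> pivot B j l ->
  vertex (exchange B j l) =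
  vertex B + leaving_ratio B j l *: pivot_direction B j.
Proof.
move=> [Bb _] [Bj ul _]; rewrite /vertex basic_solution_exchange ?gt_eqF //.
by rewrite originalD originalZ.
Qed.

Lemma vertex_degenerate B j l : feasible_basis B -> pivot B j l ->
  ~ Defs.nondegenerate B j -> vertex (exchange B j l) = vertex B.
Proof.
move=> Bf Bp /(contra_not (nondegenerate_ratio Bf Bp).2)/negP.
rewrite lt_def ratio_ge0 // andbT negbK vertex_exchange // => /eqP ->.
by rewrite scale0r addr0.
Qed.

Definition dual_feasible w B : Prop :=
  forall j, ~~ basic B j -> dot w (pivot_direction B j) <= 0.

(* A pivot on a zero reduced cost changes no other reduced cost. *)
Lemma dual_feasible_exchange w B j l : is_basis B -> ~~ basic B j ->
    tableau_col B j l 0 != 0 -> dot w (pivot_direction B j) = 0 ->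
  dual_feasible w B -> dual_feasible w (exchange B j l).
Proof.
move=> Bb Bj ul wj wB k Bk; have B'b := is_basis_exchange Bb ul.
rewrite (dot_kernel w Bb (stdA_direction k B'b)) (bigD1 j) //= wj mulr0 add0r.
apply: sumr_le0 => i /andP[Bi ij]; rewrite direction_nonbasic.
  by rewrite mulr_ge0_le0 ?ler0n ?wB.
exact: exchange_nonbasic.
Qed.

Lemma tableau_basis B i : is_basis B ->
  invmx (basis_mx B) *m col (B i) (stdA L) = delta_mx i 0.
Proof. by move=> Bb; rewrite -col_basis_mx colE mulKmx. Qed.

Definition tableau s B : 'M[R]_(nrows L, 1 + ncols L) :=
  invmx (basis_mx B) *m row_mx (stdb L) (col_perm s (stdA L)).

Lemma tableauEl s B i c : tableau s B i (lshift _ c) = basic_coords B i 0.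
Proof. by rewrite /tableau mul_mx_row row_mxEl (ord1 c). Qed.

Lemma tableauEr s B i c :
  tableau s B i (rshift 1 c) =
  (invmx (basis_mx B) *m col (s c) (stdA L)) i 0.
Proof.
rewrite /tableau mul_mx_row row_mxEr !mxE.
by apply: eq_bigr => k _; rewrite !mxE.
Qed.

Lemma tableau_exchangeE s B j l i (k : 'I_(1 + ncols L)) :
  is_basis B -> tableau_col B j l 0 != 0 ->
  tableau s B i k = tableau s (exchange B j l) i k +
  (tableau_col B j i 0 - (i == l)%:R) * tableau s (exchange B j l) l k.
Proof. by move=> Bb ul; apply: tableau_exchange. Qed.

Definition lex_feasible s B : Prop := forall i, lexpos (row i (tableau s B)).

(** If the right-hand side entry of a row is 0, the basis columns come next; there the tableau is a
    permutation matrix, so the first nonzero entry is 1. *)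
Lemma lex_feasible_first s B : feasible_basis B -> basis_first s B ->
  lex_feasible s B.
Proof.
move=> Bf sB i; have [Bb _] := Bf.
have := coords_ge0 i Bf; rewrite le_eqVlt => /orP[/eqP x0|x0]; last first.
  exists (lshift _ 0) => [|k' //]; by rewrite mxE tableauEl.
have rc : (nrows L <= ncols L)%N.
  by have := leq_card B (basis_inj Bb); rewrite !card_ord.
have [h hP] : exists h : 'I_(nrows L) -> 'I_(nrows L),
    forall p, s (widen_ord rc p) = B (h p).
  have /fin_all_exists[h hP] p : exists i', s (widen_ord rc p) = B i'.
    by apply/basicP/sB; case: p.
  by exists h.
have hI : injective h.
  move=> p p' hpp'; have /perm_inj : s (widen_ord rc p) = s (widen_ord rc p').
    by rewrite !hP hpp'.
  by move=> /(congr1 val) /= /ord_inj.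
have [g hK gK] := injF_bij hI.
have entry p : tableau s B i (rshift 1 (widen_ord rc p)) = (i == h p)%:R.
  by rewrite tableauEr hP tableau_basis // mxE andbT.
exists (rshift 1 (widen_ord rc (g i))) => [|k'].
  by rewrite mxE entry gK eqxx ltr01.
case: (split_ordP k') => c -> /= ck; rewrite mxE ?tableauEl ?x0 //.
rewrite add1n ltnS in ck; have cr : (c < nrows L)%N by apply: ltn_trans ck _.
have -> : c = widen_ord rc (Ordinal cr) by apply: val_inj.
rewrite entry; case: eqP => // ih; move: ck; rewrite ih hK /= ltnn //.
Qed.

Lemma lex_leavingP s B j l i : lex_leaving s B j l -> 0 < tableau_col B j i 0 ->
  let r := (tableau_col B j i 0)^-1 *: row i (tableau s B) -
           (tableau_col B j l 0)^-1 *: row l (tableau s B) in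
  r = 0 \/ lexpos r.
Proof.
move=> lexl ui r; have := tuplelexi_le (lexl i ui).
suff -> : \row_k (tnth (lex_row s B j i) k - tnth (lex_row s B j l) k) =
  r by [].
by apply/rowP => k; rewrite [LHS]mxE !tnth_mktuple sub_mxE !mxE.
Qed.

(** The first entry of [lex_row] is the leaving ratio, so the lexicographic rule refines the ratio
    test. *)
Lemma pivot_lex_leaving s B j l : ~~ basic B j -> 0 < tableau_col B j l 0 ->
  lex_leaving s B j l -> pivot B j l.
Proof.
move=> Bj ul lexl; split=> // i ui.
have /lexi_tupleP[k /(_ (lshift _ 0) (leq0n _))[+ _]] := lexl i ui.
by rewrite !tnth_mktuple -!/(tableau s B) !tableauEl ![_^-1 * _]mulrC.
Qed.

Lemma lex_leaving_exists s B j i : ~~ basic B j -> 0 < tableau_col B j i 0 ->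
  exists2 l, pivot B j l & lex_leaving s B j l.
Proof.
move=> Bj ui.
pose F i : (1 + ncols L)%N.-tuplelexi R := lex_row s B j i.
case: (@arg_minP _ _ _ i (fun i => 0 < tableau_col B j i 0) F ui) => l ul lmin.
by exists l => //; apply: (pivot_lex_leaving (s := s)).
Qed.

(** Row [l] is rescaled by a positive factor. Another row [i] is a sum of lexicographically positive
    rows when its entry [u] in the entering column is negative, is unchanged when [u] is 0, and
    otherwise is [u] times a difference that the leaving rule makes nonnegative. *)
Lemma lex_feasible_exchange s B j l : is_basis B -> pivot B j l ->
  lex_leaving s B j l -> lex_feasible s B -> lex_feasible s (exchange B j l).
Proof.
move=> Bb [Bj ul _] lexl lexB i; have ul0 := lt0r_neq0 ul.
have B'b := is_basis_exchange Bb ul0; set B' := exchange B j l in B'b *.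
have rowl : row l (tableau s B') =
  (tableau_col B j l 0)^-1 *: row l (tableau s B).
  apply/rowP => k; rewrite [RHS]mxE !row_coefE.
  by rewrite (tableau_exchangeE s l k Bb ul0) eqxx -/B' /=; field.
have [->|il] := eqVneq i l; first by rewrite rowl;
  apply: lexposZ; rewrite ?invr_gt0.
set u := tableau_col B j i 0.
have rowi : row i (tableau s B') =
  row i (tableau s B) - u *: row l (tableau s B').
  apply/rowP => k; rewrite sub_mxE [X in _ - X]mxE !row_coefE.
  by rewrite (tableau_exchangeE s i k Bb ul0) (negPf il) -/B' -/u /=; ring.
(* The entry of this row in its own basis column is 1, which excludes ties. *)
have rowi0 : row i (tableau s B') != 0.
  apply/eqP => /rowP/(_ (rshift 1 (s^-1%g (B' i))));
    rewrite mxE tableauEr permKV.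
  by rewrite tableau_basis // !mxE !eqxx => /eqP; rewrite oner_eq0.
have [u0|u0|u0] := ltgtP 0 u.
- have [ri|ri] := lex_leavingP lexl u0.
    case/eqP: rowi0;
      rewrite rowi rowl -[X in X - _]scale1r -(divff (lt0r_neq0 u0)).
    by rewrite -scalerA -scalerBr ri scaler0.
  have -> : row i (tableau s B') = u *: (u^-1 *: row i (tableau s B) -
           (tableau_col B j l 0)^-1 *: row l (tableau s B)).
    by rewrite rowi scalerBr -rowl scalerA divff ?gt_eqF // scale1r.
  exact: lexposZ.
- rewrite rowi -scaleNr; apply: lexposD => //; apply: lexposZ;
  first by rewrite oppr_gt0.
  by rewrite rowl; apply: lexposZ; rewrite ?invr_gt0.
- by rewrite rowi -u0 scale0r subr0.
Qed.

(** With [w] extended by 0 on slacks, this is the row $w_B^\top A_B'^{-1}[b'\mid A']$; its first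
    entry is the objective value at the vertex. *)
Definition objective_row s w B : 'rV[R]_(1 + ncols L) :=
  (\row_i (col_mx w 0 : 'cV_(ncols L)) (B i) 0) *m tableau s B.

Lemma dot_original w y : dot w (original y) = dot (col_mx w 0) y.
Proof.
rewrite /dot -[in RHS](vsubmxK y) tr_col_mx mul_row_col.
by rewrite trmx0 mul0mx addr0.
Qed.

Lemma dot_direction B w j :
  let g : 'cV[R]_(ncols L) := col_mx w 0 in
  dot w (pivot_direction B j) =
  g j 0 - \sum_i g (B i) 0 * tableau_col B j i 0.
Proof.
move=> g; rewrite dot_original -/g dotBr /dot -colE !mxE; congr (_ - _).
rewrite [RHS](partition_big B predT) //=; apply: eq_bigr => k _.
by rewrite [embed _ _ _ _]mxE mulr_sumr; apply: eq_bigr => i /eqP <-;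
  rewrite mxE.
Qed.

Lemma objective_row_exchange s w B j l :
  is_basis B -> tableau_col B j l 0 != 0 ->
  objective_row s w (exchange B j l) - objective_row s w B =
  dot w (pivot_direction B j) *: row l (tableau s (exchange B j l)).
Proof.
move=> Bb ul; rewrite dot_direction; set g : 'cV_(ncols L) := col_mx w 0.
set B' := exchange B j l; apply/rowP => k.
have rowE C : objective_row s w C 0 k = \sum_i g (C i) 0 * tableau s C i k.
  by rewrite mxE; apply: eq_bigr => i _; rewrite mxE.
rewrite sub_mxE [RHS]mxE row_coefE !rowE.
have -> : \sum_i g (B i) 0 * tableau s B i k =
    \sum_i g (B i) 0 * tableau s B' i k +
    (\sum_i g (B i) 0 * tableau_col B j i 0 - g (B l) 0) * tableau s B' l k.
  rewrite mulrBl mulr_suml addrA -big_split /= [LHS](bigD1 l) //=.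
  rewrite [in RHS](bigD1 l) //=.
  rewrite (tableau_exchangeE s l k Bb ul) eqxx -/B' /=.
  under eq_bigr => i il do rewrite (tableau_exchangeE s i k Bb ul) (negPf il)
    subr0 mulrDr mulrA.
  rewrite -/B'; ring.
rewrite [X in X - _](bigD1 l) //= [X in _ - (X + _)](bigD1 l) //= ffunE eqxx.
under eq_bigr => i il do rewrite ffunE (negPf il).
ring.
Qed.

Definition lex_step s w B B' : Prop := exists j l,
  [/\ 0 < dot w (pivot_direction B j), pivot B j l, lex_leaving s B j l
    & B' = exchange B j l].

(** The objective row changes by a positive reduced cost times a lexicographically positive row, so
    no basis recurs. The objective [w] is free: Phase 1 uses $c-v$ and Phase 2 uses $c$. *)
Lemma no_infinite_lex_run s w (f : nat -> basis L) :
  feasible_basis (f 0) -> lex_feasible s (f 0) ->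
  ~ forall t, lex_step s w (f t) (f t.+1).
Proof.
move=> f0 l0 fS.
have inv t : feasible_basis (f t) /\ lex_feasible s (f t).
  elim: t => // t [ft lt]; have [j [l [_ Bp lexl ->]]] := fS t.
  by split; [apply: feasible_exchange | apply: lex_feasible_exchange => //;
    case: ft].
have inc t : lexpos (objective_row s w (f t.+1) - objective_row s w (f t)).
  have [Bf Bl] := inv t; have [B'f B'l] := inv t.+1.
  have [j [l [wj Bp lexl e]]] := fS t.
  have [Bb _] := Bf; have [_ ul _] := Bp; rewrite e in B'l *.
  by rewrite objective_row_exchange ?gt_eqF //; apply: lexposZ.
have incD t d :
    lexpos (objective_row s w (f (t + d).+1) - objective_row s w (f t)).
  elim: d => [|d IHd]; first by rewrite addn0.
  by rewrite addnS -(subrKA (objective_row s w (f (t + d).+1))); apply: lexposD.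
have fI : injective f.
  suff lt t t' : (t < t')%N -> f t <> f t'.
    by move=> t t' e; case: (ltngtP t t') => // /lt; rewrite e.
  move=> /subnKC <-; rewrite addSn => e.
  by have /lexpos_neq0 := incD t (t' - t.+1)%N; rewrite -e subrr eqxx.
(* There are finitely many bases, so one more index than bases contradicts injectivity. *)
have := leq_card (fun t : 'I_#|basis L|.+1 => f t)
  (fun t t' e => ord_inj (fI _ _ e)).
by rewrite card_ord ltnn.
Qed.

End Pivots.

(** * Optimality and the basic cone *)

Lemma comb_mxE (V : pzRingType) p r (a b : V) (A C : 'M[V]_(p, r)) i j :
  (a *: A + b *: C) i j = a * A i j + b * C i j.
Proof. by rewrite !mxE. Qed.

Section Optimality.
Variables (R : realFieldType) (m n q : nat) (L : linprog R m n q).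
Implicit Types (B : basis L) (j k : 'I_(ncols L)) (l i : 'I_(nrows L)).
Implicit Types (x z w v : 'cV[R]_n) (y : 'cV[R]_(ncols L)) (lam : R).

Lemma basic_cone_original B y : stdA L *m y = 0 ->
  (forall k, ~~ basic B k -> 0 <= y k 0) -> basic_cone B (original y).
Proof.
move=> /stdA_kernel[Ay ye] yN; split=> // [k Bk|i Bi]; first by rewrite mxE yN.
have := yN _ Bi; rewrite {1}ye /extend col_mxEd sub_mxE [X in X - _]mxE sub0r.
by rewrite oppr_ge0.
Qed.

Lemma basic_cone_extend B z : basic_cone B z ->
  stdA L *m extend (L := L) 0 z = 0 /\
  forall k, ~~ basic B k -> 0 <= extend (L := L) 0 z k 0.
Proof.
move=> [Az z0 Dz]; split=> [|k]; first by rewrite stdA_extend Az col_mx0.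
rewrite /extend; case: (split_ordP k) => t -> Bt; first by rewrite col_mxEu z0.
by rewrite col_mxEd sub_mxE mxE sub0r oppr_ge0 Dz.
Qed.

Lemma basic_cone_direction B j : is_basis B -> ~~ basic B j ->
  basic_cone B (pivot_direction B j).
Proof.
move=> Bb Bj; apply: basic_cone_original; first exact: stdA_direction.
by move=> k Bk; rewrite direction_nonbasic // ler0n.
Qed.

Lemma basic_cone_comb B (a b : R) z1 z2 : 0 <= a -> 0 <= b ->
  basic_cone B z1 -> basic_cone B z2 -> basic_cone B (a *: z1 + b *: z2).
Proof.
move=> a0 b0 [A1 z10 D1] [A2 z20 D2]; split=> [|k Bk|i Bi].
- by rewrite mulmxDr -!scalemxAr A1 A2 !scaler0 addr0.
- by rewrite comb_mxE addr_ge0 // mulr_ge0 ?z10 ?z20.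
- rewrite mulmxDr -!scalemxAr comb_mxE.
  by rewrite -[leRHS]addr0 lerD // mulr_ge0_le0 ?D1 ?D2.
Qed.

Lemma dot_cone_le0 w B z : is_basis B -> dual_feasible w B -> basic_cone B z ->
  dot w z <= 0.
Proof.
move=> Bb wB /basic_cone_extend[Az zN].
rewrite -(original_extend (L := L) 0 z) (dot_kernel w Bb Az).
by apply: sumr_le0 => j Bj; rewrite mulr_ge0_le0 ?zN ?wB.
Qed.

(** The difference of the lifted points is a kernel vector with nonnegative nonbasic coordinates,
    hence a nonnegative combination of pivot directions. *)
Lemma dual_feasible_optimal w B x : has_nonneg_rows L -> feasible_basis B ->
  dual_feasible w B -> polyhedron L x -> dot w x <= dot w (vertex B).
Proof.
move=> Dn [Bb B0] wB Px; have [Ax x0] := std_feasible_extend Dn Px.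
rewrite -subr_le0 -dotBr -(original_extend (L := L) (slackd L) x) -originalB.
rewrite (dot_kernel w Bb) ?mulmxBr ?Ax ?stdA_basic_solution ?subrr //.
apply: sumr_le0 => j Bj; rewrite mulr_ge0_le0 ?wB // sub_mxE.
by rewrite embed_nonbasic // subr0.
Qed.

(** Otherwise the whole ray along the pivot direction is feasible, and the direction is nonzero
    because [w] is positive on it. *)
Lemma bounded_column w B j : bounded (polyhedron L) -> feasible_basis B ->
  ~~ basic B j -> 0 < dot w (pivot_direction B j) ->
  exists i, 0 < tableau_col B j i 0.
Proof.
move=> [M PM] Bf Bj wj; apply: contrapT => /forallNP u0.
have [Bb B0] := Bf; have [Ab _] := std_feasible_basic Bf.
have ray (t : R) : 0 <= t -> polyhedron L (vertex B + t *: pivot_direction B j).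
  move=> t0; rewrite -originalZ -originalD; apply: polyhedron_original; split.
    by rewrite mulmxDr -scalemxAr stdA_direction // scaler0 addr0.
  move=> k; rewrite mxE addr_ge0 // mxE mulr_ge0 //.
  have [/basicP[i ->]|Bk] := boolP (basic B k).
    by rewrite direction_basic // oppr_ge0 leNgt; apply/negP/u0.
  by rewrite direction_nonbasic // ler0n.
have [k dk] : exists k : 'I_n, pivot_direction B j k 0 != 0.
  apply: contrapT => /forallNP d0; move: wj; rewrite dotE big1 ?ltxx // => k _.
  by have /negP := d0 k; rewrite negbK => /eqP ->; rewrite mulr0.
set d := pivot_direction B j in dk ray.
have M0 : 0 <= M by apply: le_trans (PM _ (polyhedron_vertex Bf) k).
(* This step shifts coordinate [k] by one more than the bound [M] permits. *)
pose t := (M + `|vertex B k 0| + 1) / `|d k 0|.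
have nd : 0 < `|d k 0| by rewrite normr_gt0.
have t0 : 0 <= t by rewrite divr_ge0 // !addr_ge0.
have := PM _ (ray t t0) k; rewrite mxE [X in _ + X]mxE => tM.
have : `|t * d k 0| <= M + `|vertex B k 0|.
  rewrite -[t * _](addKr (vertex B k 0)) addrC.
  by apply: le_trans (ler_normB _ _) _; rewrite lerD2r.
rewrite normrM (ger0_norm t0) divfK ?gt_eqF // gerDl.
by rewrite ler10.
Qed.

Lemma lex_step_exists s w B j : bounded (polyhedron L) -> feasible_basis B ->
  ~~ basic B j -> 0 < dot w (pivot_direction B j) ->
  exists2 l, pivot B j l & lex_leaving s B j l.
Proof.
move=> bP Bf Bj wj; have [i ui] := bounded_column bP Bf Bj wj.
exact: (lex_leaving_exists s Bj ui).
Qed.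

(** On the cone $c^\top z\le\lambda v^\top z$, so a positive left side forces $v^\top z>0$. *)
Lemma cone_condition_dual v lam B : is_basis B -> 0 <= lam ->
  dual_feasible (lpc L - lam *: v) B -> cone_condition v B.
Proof.
move=> Bb lam0 cvB z Cz cz; have := dot_cone_le0 Bb cvB Cz.
rewrite dotBZl subr_le0 => /(lt_le_trans cz) lv.
by rewrite ltNge; apply: contraTN lv => v0; rewrite -leNgt mulr_ge0_le0.
Qed.

(** * Slopes under the cone condition *)

Section Slope.
Variables (v : 'cV[R]_n) (B : basis L).
Hypotheses (Bb : is_basis B) (Bv : cone_condition v B).

Lemma improving_gt0 j : improving B j -> 0 < dot v (pivot_direction B j).
Proof. by move=> [Bj cj]; apply: Bv => //; apply: basic_cone_direction. Qed.

Lemma shadow_entering_exists : ~ stops B -> exists j, shadow_entering v B j.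
Proof.
move=> /existsNP[j0 /not_implyP[Bj0 /negP]]; rewrite -ltNge => cj0.
pose P j := `[< improving B j >].
have Pj0 : P j0 by apply/asboolP.
case: (@arg_maxP _ _ _ j0 P (slope v B) Pj0) => j /asboolP Ij jmax.
exists j; split=> // i Ii; split; first by rewrite gt_eqF // improving_gt0.
by apply: jmax; apply/asboolP.
Qed.

(** The slope is the multiplier cancelling the reduced cost of [j]. Maximality handles the improving
    directions and signs handle those with $v^\top z^i\ge 0$; the rest need the cone condition at a
    vector that is not a generator. *)
Lemma shadow_entering_dual j : shadow_entering v B j ->
  [/\ 0 < slope v B j, 0 < dot v (pivot_direction B j),
      dot (lpc L - slope v B j *: v) (pivot_direction B j) = 0
    & dual_feasible (lpc L - slope v B j *: v) B].
Proof.
move=> [Ij jmax]; have vj := improving_gt0 Ij; have [Bj cj] := Ij.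
have s0 : 0 < slope v B j by rewrite divr_gt0.
have cE : reduced_cost B j = slope v B j * dot v (pivot_direction B j).
  by rewrite divfK // gt_eqF.
split=> // [|i Bi]; rewrite dotBZl; first by rewrite -cE subrr.
rewrite subr_le0.
have [ci|ci] := ltP 0 (reduced_cost B i).
  have Ii : improving B i by [].
  by rewrite -ler_pdivrMr ?improving_gt0 // (jmax i Ii).2.
have [vi|vi] := leP 0 (dot v (pivot_direction B i)).
  by apply: le_trans ci _; rewrite mulr_ge0 // ltW.
(* The cone contains a combination of both directions orthogonal to [v]. *)
pose t := - dot v (pivot_direction B i) / dot v (pivot_direction B j).
have t0 : 0 <= t by rewrite divr_ge0 ?oppr_ge0 // ltW.
have Cz : basic_cone B (1 *: pivot_direction B i + t *: pivot_direction B j).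
  by apply: basic_cone_comb => //; apply: basic_cone_direction.
have vz : dot v (1 *: pivot_direction B i + t *: pivot_direction B j) = 0.
  by rewrite dotDr !dotZr mul1r divfK ?gt_eqF // addrN.
have : dot (lpc L) (1 *: pivot_direction B i + t *: pivot_direction B j) <= 0.
  by rewrite leNgt; apply/negP => /(Bv Cz); rewrite vz ltxx.
rewrite dotDr !dotZr mul1r -/(reduced_cost B j) cE.
rewrite [t * _]mulrCA divfK ?gt_eqF //; lra.
Qed.

(** Converse of [cone_condition_dual]: the multiplier is the maximal slope, or 0 at a stopping
    basis. *)
Lemma cone_condition_slope :
  exists2 lam, 0 <= lam & dual_feasible (lpc L - lam *: v) B.
Proof.
have [Bs|/shadow_entering_exists[j /shadow_entering_dual[s0 _ _ sB]]] :=
  pselect (stops B).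
  by exists 0 => // j Bj; rewrite scale0r subr0 Bs.
by exists (slope v B j) => //; apply: ltW.
Qed.

End Slope.

Lemma basis_first_exists B : is_basis B -> exists s, basis_first s B.
Proof.
move=> Bb; have BI := basis_inj Bb.
pose r := codom B ++ [seq k <- enum 'I_(ncols L) | ~~ basic B k].
have ru : uniq r.
  rewrite cat_uniq; apply/and3P; split.
  - by apply/injectiveP.
  - by apply/hasPn => k; rewrite mem_filter => /andP[].
  - by apply: filter_uniq; apply: enum_uniq.
have rP : perm_eq r (enum 'I_(ncols L)).
  apply: uniq_perm => //; first exact: enum_uniq.
  by move=> k; rewrite mem_cat mem_filter mem_enum andbT orbN.
have rs : size r = ncols L by rewrite (perm_size rP) size_enum_ord.
(* The default of [nth] is the index itself, as ['I_(ncols L)] may be empty; it is never reached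
   because [r] has full length. *)
have rI : injective (fun p : 'I_(ncols L) => nth p r p).
  move=> p p'; rewrite (set_nth_default p' p) ?rs // => /eqP.
  by rewrite nth_uniq ?rs // => /eqP/ord_inj.
exists (perm rI) => p pr; rewrite permE nth_cat size_codom card_ord pr.
by rewrite /basic mem_nth // size_codom card_ord.
Qed.

End Optimality.

(** * Affine dimension and the shadow vector *)

Section AffineDimension.
Variables (R : realFieldType) (n : nat).
Implicit Types (x : 'cV[R]_n) (S : set 'cV[R]_n).

Definition append_point k (p : 'I_k.+1 -> 'cV[R]_n) x (i : 'I_k.+2) :
  'cV[R]_n :=
  if unlift ord_max i is Some i' then p i' else x.

Lemma append_point_max k (p : 'I_k.+1 -> 'cV[R]_n) x :
  append_point p x ord_max = x.
Proof. by rewrite /append_point unlift_none. Qed.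

Lemma append_point_lift k (p : 'I_k.+1 -> 'cV[R]_n) x i :
  append_point p x (lift ord_max i) = p i.
Proof. by rewrite /append_point liftK. Qed.

(** Coordinate [t] is constant on the old points, so in a vanishing combination it kills the
    coefficient of [x]; independence of [p] kills the others. *)
Lemma affinely_independent_append k (p : 'I_k.+1 -> 'cV[R]_n) x t :
  affinely_independent p -> (forall i, p i t 0 = p ord0 t 0) ->
  x t 0 != p ord0 t 0 -> affinely_independent (append_point p x).
Proof.
move=> pI pt xt; apply: inj_row_free => v.
have e0 : append_point p x ord0 = p ord0.
  have -> : ord0 = lift ord_max (ord0 : 'I_k.+1) by apply: val_inj.
  exact: append_point_lift.
have eL (i : 'I_k) :
  append_point p x (lift ord0 (widen_ord (leqnSn k) i)) = p (lift ord0 i).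
  rewrite -(append_point_lift p x); congr append_point; apply: val_inj => /=.
  by rewrite /bump [in RHS]leqNgt ltnS ltn_ord.
have eM : append_point p x (lift ord0 ord_max) = x.
  rewrite -{2}(append_point_max p x); congr append_point; exact: val_inj.
move=> /rowP v0.
have eq0 t' :
    \sum_(i < k) v 0 (widen_ord (leqnSn k) i) *
      (p (lift ord0 i) t' 0 - p ord0 t' 0) +
    v 0 ord_max * (x t' 0 - p ord0 t' 0) = 0.
  have := v0 t'; rewrite [RHS]mxE => e;
    rewrite -[RHS]e mxE big_ord_recr /= !mxE eM e0.
  by congr (_ + _); apply: eq_bigr => i _; rewrite !mxE eL.
have vM : v 0 ord_max = 0.
  have /eqP := eq0 t; rewrite big1 => [|i _]; last by rewrite pt subrr mulr0.
  by rewrite add0r mulf_eq0 subr_eq0 (negPf xt) orbF => /eqP.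
have vW : \row_(i < k) v 0 (widen_ord (leqnSn k) i) = 0.
  apply/eqP; rewrite -(mulmx_free_eq0 _ pI); apply/eqP/rowP => t'.
  have := eq0 t'; rewrite vM mul0r addr0 => e; rewrite [RHS]mxE -[RHS]e mxE.
  by apply: eq_bigr => i _; rewrite !mxE.
apply/rowP => i; rewrite [RHS]mxE; case: (unliftP ord_max i) => [i' ->|-> //].
have /rowP/(_ i') := vW; rewrite !mxE => e; rewrite -[RHS]e; congr (v 0 _);
  apply: val_inj => /=.
by rewrite /bump leqNgt ltn_ord.
Qed.

Lemma affine_dim_ge k (p : 'I_k.+1 -> 'cV[R]_n) S :
  affinely_independent p -> (forall i, S (p i)) -> (k <= affine_dim S)%N.
Proof.
move=> pI pS.
(* The maximum defining [affine_dim] ranges only over [k <= n]; a row-free matrix with [n] columns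
   has at most [n] rows. *)
have kn : (k < n.+1)%N.
  by rewrite ltnS; move/eqP: (pI) => <-; apply: rank_leq_col.
by apply: (@leq_bigmax_cond _ _ _ (Ordinal kn)); apply/asboolP; exists p.
Qed.

End AffineDimension.

Section ShadowVector.
Variables (R : realFieldType) (m n q : nat) (L : linprog R m n q).

Definition is01 (x : 'cV[R]_n) : Prop := forall k, x k 0 = 0 \/ x k 0 = 1.

Local Notation C := (cstar L).

(* Bounds the part of [v^T d] carried by the coordinates below [h]. *)
Definition power_sum (h : nat) : R := \sum_(i < h) C ^+ i.+1.

Lemma cstar_ge2 : 2 <= C.
Proof. by rewrite lerDr sumr_ge0. Qed.

Lemma cstar_gt0 : 0 < C.
Proof. by apply: lt_le_trans cstar_ge2. Qed.

Lemma power_sumS h : power_sum h.+1 = power_sum h + C ^+ h.+1.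
Proof. by rewrite /power_sum big_ord_recr. Qed.

Lemma power_sum_ge0 h : 0 <= power_sum h.
Proof. by apply: sumr_ge0 => i _; rewrite exprn_ge0 // ltW ?cstar_gt0. Qed.

(** The geometric sum formula, arranged to compare the least possible $v^\top d$ with the largest
    cost $C-2$. *)
Lemma power_sum_geometric h :
  C ^+ h.+1 - power_sum h = (C - 2) * power_sum h + C.
Proof.
elim: h => [|h IHh]; first by rewrite /power_sum big_ord0; ring.
have e : C ^+ h.+1 =
  (C - 2) * power_sum h + C + power_sum h by rewrite -IHh subrK.
by rewrite power_sumS exprS e; ring.
Qed.

Lemma le_power_sum h h' : (h <= h')%N -> power_sum h <= power_sum h'.
Proof.
move=> /subnKC <-; elim: (h' - h)%N => [|d IHd]; first by rewrite addn0.
by rewrite addnS power_sumS (le_trans IHd) // lerDl exprn_ge0 // ltW ?cstar_gt0.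
Qed.

Variable x0 : 'cV[R]_n.
Local Notation v := (shadow_vector L x0).

Lemma shadow_norm k : `|v k 0| = C ^+ k.+1.
Proof.
rewrite mxE normrM normrX normrN1 expr1n mul1r ger0_norm //.
by rewrite exprn_ge0 // ltW ?cstar_gt0.
Qed.

Lemma dot_shadow_leading (d : 'cV[R]_n) (H : 'I_n) :
  (forall k, `|d k 0| <= 1) -> (forall k : 'I_n, (H < k)%N -> d k 0 = 0) ->
  `|dot v d - v H 0 * d H 0| <= power_sum H.
Proof.
move=> d1 dH; rewrite dotE (bigD1 H) //= addrAC subrr add0r.
rewrite /power_sum (big_ord_widen n (fun i => C ^+ i.+1)) 1?ltnW //.
rewrite (bigID (fun k : 'I_n => k < H)%N) /=.
rewrite [X in _ + X]big1 => [|k /andP[kH Hk]].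
  rewrite addr0; apply: le_trans (ler_norm_sum _ _ _) _.
  rewrite [leRHS](eq_bigl (fun k : 'I_n => (k != H) && (k < H)%N)) => [|k].
    apply: ler_sum => k _; rewrite normrM shadow_norm.
    by rewrite ler_piMr // exprn_ge0 // ltW ?cstar_gt0.
  by case: eqVneq => //= ->; rewrite ltnn.
by rewrite dH ?mulr0 // ltn_neqAle eq_sym leqNgt Hk andbT.
Qed.

Lemma leading_coordinate (d : 'cV[R]_n) : d != 0 ->
  exists2 H : 'I_n, d H 0 != 0 & forall k : 'I_n, (H < k)%N -> d k 0 = 0.
Proof.
move=> d0; have [k0 dk0] : exists k, d k 0 != 0.
  by apply: contrapT => /forallNP dN; case/eqP: d0; apply/colP => k;
     have /negP := dN k; rewrite negbK mxE => /eqP.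
case: (@arg_maxnP _ k0 (fun k => d k 0 != 0) (fun k => k) dk0) => H dH Hmax.
exists H => // k Hk; apply/eqP; apply: contraTT Hk => /Hmax; rewrite -leqNgt;
  exact.
Qed.

Section Differences.
Variables x y : 'cV[R]_n.
Hypotheses (x01 : is01 x) (y01 : is01 y).

Lemma is01_diff_norm k : `|(y - x) k 0| <= 1.
Proof.
rewrite sub_mxE; case: (x01 k) (y01 k) => -> [] ->;
  by rewrite ?subrr ?subr0 ?sub0r ?normrN ?normr0 ?normr1 ?ler01.
Qed.

(** [C - 2] is the $\ell_1$ norm of the cost vector, and the entries of the difference are at most 1
    in absolute value. *)
Lemma dot_cost_le : dot (lpc L) (y - x) <= C - 2.
Proof.
rewrite /cstar addrK dotE; apply: ler_sum => k _.
apply: le_trans (ler_norm _) _; rewrite normrM ler_piMr //;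
  exact: is01_diff_norm.
Qed.

Lemma dot_cost_ge1 : integral_mx (lpc L) ->
  0 < dot (lpc L) (y - x) -> 1 <= dot (lpc L) (y - x).
Proof.
move=> [c cE].
have intE z : is01 z -> forall k, z k 0 = (z k 0 == 1)%:R%:~R.
  by move=> z01 k; case: (z01 k) => ->; rewrite ?eqxx // eq_sym oner_eq0.
have -> : dot (lpc L) (y - x) =
    (\sum_k c k 0 * ((y k 0 == 1)%:R - (x k 0 == 1)%:R))%:~R.
  rewrite rmorph_sum dotE; apply: eq_bigr => k _ /=.
  by rewrite rmorphM rmorphB /= -(intE _ y01) -(intE _ x01) cE mxE sub_mxE.
by rewrite ltr0z ler1z.
Qed.

(** The sign of [v] at [H] rewards leaving the value of [x0] and penalizes returning to it. *)
Lemma shadow_leading_sign (H : 'I_n) : is01 x0 -> (y - x) H 0 != 0 ->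
  v H 0 * (y - x) H 0 = if x H 0 == x0 H 0 then C ^+ H.+1 else - C ^+ H.+1.
Proof.
move=> x001; rewrite sub_mxE subr_eq0 mxE.
case: (x001 H) (x01 H) (y01 H) => -> [] -> [] ->;
  rewrite ?eqxx //= ?(eq_sym 0 1) ?oner_eq0 //= ?expr0 ?expr1 => _; ring.
Qed.

End Differences.
End ShadowVector.

(** * Moves of the ordered shadow rule *)

Section ShadowMoves.
Variables (R : realFieldType) (m n q : nat) (L : linprog R m n q).
Variables x0 x y : 'cV[R]_n.
Hypotheses (x001 : is01 x0) (x01 : is01 x) (y01 : is01 y).
Local Notation v := (shadow_vector L x0).

Lemma leading_move : y != x -> exists H : 'I_n,
  [/\ y H 0 != x H 0, forall k : 'I_n, (H < k)%N -> y k 0 = x k 0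
    & `|dot v (y - x) -
        (if x H 0 == x0 H 0 then cstar L ^+ H.+1 else - cstar L ^+ H.+1)|
      <= power_sum L H].
Proof.
rewrite -subr_eq0 => /leading_coordinate[H dH d0]; exists H; split.
- by rewrite -subr_eq0 -sub_mxE.
- by move=> k /d0/eqP; rewrite sub_mxE subr_eq0 => /eqP.
- rewrite -(shadow_leading_sign L x01 y01 x001 dH).
  by apply: dot_shadow_leading => //; apply: is01_diff_norm.
Qed.

(** The cost of the move lies between 1 and $C-2$, which confines [lam] to the window
    $1/S_{H+1}\le\lambda<1/S_H$, with $S$ for [power_sum L]. Windows of distinct [H] are disjoint,
    so the slope determines [H]. *)
Lemma shadow_move (lam : R) : integral_mx (lpc L) -> 0 < lam ->
  0 < dot v (y - x) -> dot (lpc L) (y - x) = lam * dot v (y - x) ->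
  exists H : 'I_n,
  [/\ x H 0 = x0 H 0, y H 0 != x H 0,
      forall k : 'I_n, (H < k)%N -> y k 0 = x k 0,
      1 <= lam * power_sum L H.+1 & lam * power_sum L H < 1].
Proof.
move=> cint lam0 vd cd.
have yx : y != x by apply: contraTneq vd => ->; rewrite subrr dot0r ltxx.
have [H [yxH yxk]] := leading_move yx; rewrite ler_norml => /andP[lo hi].
have geo := power_sum_geometric L H; have C2 := cstar_ge2 L.
have S0 := power_sum_ge0 L H.
(* A move returning coordinate [H] to its start value would make $v^\top d$ negative. *)
have xH : x H 0 = x0 H 0.
  apply/eqP; apply: contraLR vd => /negPf xH; rewrite xH in hi; rewrite -leNgt.
  have : 0 <= (cstar L - 2) * power_sum L H by rewrite mulr_ge0 // subr_ge0.
  by lra.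
rewrite xH eqxx in lo hi.
have c1 : 1 <= dot (lpc L) (y - x).
  by apply: dot_cost_ge1 => //; rewrite cd mulr_gt0.
have c2 := dot_cost_le L x01 y01.
exists H; split=> //.
  apply: le_trans c1 _; rewrite cd ler_pM2l // power_sumS; lra.
(* Otherwise the cost would be at least $\lambda((C-2)S_H+C)$, which exceeds $C-2$. *)
rewrite ltNge; apply/negP => lamS.
have : lam * ((cstar L - 2) * power_sum L H + cstar L) <= cstar L - 2.
  by apply: le_trans c2; rewrite cd ler_pM2l //; lra.
have : (cstar L - 2) * 1 <= (cstar L - 2) * (lam * power_sum L H).
  by rewrite ler_wpM2l // subr_ge0.
have : 0 < lam * cstar L by rewrite mulr_gt0 ?cstar_gt0.
by lra.
Qed.

End ShadowMoves.

(** * Running the two phases *)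

Section OrderedShadowRule.
Variables (R : realFieldType) (m n q : nat) (L : linprog R m n q).
Hypotheses (Dnonneg : has_nonneg_rows L).
Hypotheses (P01 : zero_one_polytope (polyhedron L)).
Implicit Types (B : basis L) (s : 'S_(ncols L)) (v : 'cV[R]_n).

Lemma is01_vertex B : feasible_basis B -> is01 (vertex B).
Proof. by move=> Bf; apply: P01.2; apply: extreme_vertex. Qed.

Lemma feasible_degenerate_pivots B0 B :
  feasible_basis B0 -> degenerate_pivots B0 B -> feasible_basis B.
Proof.
by move=> B0f; elim=> // {}B j l _ Bf Bp _; apply: feasible_exchange.
Qed.

Lemma feasible_phase1 v B0 B1 :
  feasible_basis B0 -> phase1 v B0 B1 -> feasible_basis B1.
Proof.
by move=> B0f [[_ ->]|[_ B01 _]] //; apply: feasible_degenerate_pivots B01.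
Qed.

Lemma cone_condition_phase1 v B0 B1 : phase1 v B0 B1 -> cone_condition v B1.
Proof. by case=> [[B0c ->]|[]]. Qed.

(** Every move from [x0] has its leading coordinate leaving [x0], so $v^\top d\ge C$, more than any
    cost. The factor 1 is the multiplier [lam] of the later arguments. *)
Lemma start_maximal (x0 y : 'cV[R]_n) : is01 x0 -> is01 y ->
  dot (lpc L - 1 *: shadow_vector L x0) (y - x0) <= 0.
Proof.
move=> x001 y01; have [->|yx] := eqVneq y x0; first by rewrite subrr dot0r.
have [H [_ _]] := leading_move L x001 x001 y01 yx.
rewrite eqxx dotBZl mul1r ler_norml => /andP[lo _].
have geo := power_sum_geometric L H.
have : 0 <= (cstar L - 2) * power_sum L H.
  by rewrite mulr_ge0 ?power_sum_ge0 // subr_ge0 cstar_ge2.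
have := dot_cost_le L x001 y01; lra.
Qed.

Lemma phase1_exists B0 : feasible_basis B0 ->
  exists B1, phase1 (shadow_vector L (vertex B0)) B0 B1.
Proof.
move=> B0f; set v := shadow_vector _ _.
have [B0c|B0c] := pselect (cone_condition v B0); first by exists B0; left.
have [s sB0] := basis_first_exists B0f.1.
pose w := lpc L - 1 *: v.
pose good B := [/\ feasible_basis B,
  degenerate_pivots B0 B & vertex B = vertex B0].
have [[B [Bf B0B _] Bw]|stuck] :=
  pselect (exists2 B, good B & dual_feasible w B).
  exists B; right; split=> //.
  exact: (cone_condition_dual (v := v) Bf.1 ler01 Bw).
(* Stated for every [B], with [good B] as a premise, so that [choice] yields a total function to
   iterate. *)
have step B : exists B', good B -> good B' /\ lex_step s w B B'.
  have [[Bf B0B Bx]|nB] := pselect (good B); last by exists B.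
  have /existsNP[j /not_implyP[Bj /negP]] : ~ dual_feasible w B.
    by move=> Bw; apply: stuck; exists B.
  rewrite -ltNge => wj; have [l Bp lexl] := lex_step_exists s P01.1 Bf Bj wj.
  have B'f := feasible_exchange Bf Bp.
  (* A non-degenerate pivot would reach a 0/1 vertex better for [w] than the start vertex. *)
  have nd : ~ Defs.nondegenerate B j.
    move/(nondegenerate_ratio Bf Bp) => r0.
    have := start_maximal (is01_vertex B0f) (is01_vertex B'f).
    rewrite vertex_exchange // Bx addrAC subrr add0r dotZr leNgt.
    by rewrite mulr_gt0.
  exists (exchange B j l) => _; split; last by exists j, l.
  by split=> //; [apply: degenerate_step | rewrite vertex_degenerate].
have [g gP] := choice step.
have goodg t : good (iter t g B0).
  elim: t => [|t /gP[]] //; split=> //; exact: degenerate_nil.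
case: (@no_infinite_lex_run _ _ _ _ L s w (fun t => iter t g B0)) => //.
  exact: lex_feasible_first.
by move=> t; have /gP[] := goodg t.
Qed.

Section Phase2.
Variables (x0 : 'cV[R]_n) (s : 'S_(ncols L)).
Hypotheses (x001 : is01 x0) (cint : integral_mx (lpc L)).
Local Notation v := (shadow_vector L x0).

(* [h] exceeds the leading coordinate of every non-degenerate move made so far,
   the last one being [h.-1] (and [h = 0] before any such move); [lam] bounds
   the slopes still to come and [p] lists the vertices visited. *)
Definition shadow_invariant k B : Prop :=
  feasible_basis B /\ exists lam h (p : 'I_k.+1 -> 'cV[R]_n),
  [/\ [/\ 0 <= lam, dual_feasible (lpc L - lam *: v) B
        & lam * power_sum L h.-1 < 1],
      forall i : 'I_n, i.+1 = h -> vertex B i 0 != x0 i 0,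
      affinely_independent p, forall i, polyhedron L (p i)
    & forall i (t : 'I_n), (h <= t)%N -> p i t 0 = vertex B t 0].

Lemma shadow_invariant_cone k B : shadow_invariant k B -> cone_condition v B.
Proof.
by move=> [[Bb _] [lam [h [p [[lam0 Bd _] _ _ _ _]]]]];
  apply: cone_condition_dual Bd.
Qed.

Lemma shadow_invariant_start B : feasible_basis B -> cone_condition v B ->
  shadow_invariant 0 B.
Proof.
move=> Bf Bc; split=> //; have [lam lam0 Bd] := cone_condition_slope Bf.1 Bc.
exists lam, 0%N, (fun=> vertex B); split=> // [||i].
(* Since [0.-1] is 0, the power sum is empty and the bound holds for any [lam]. *)
- by split=> //; rewrite /power_sum big_ord0 mulr0 ltr01.
- by apply: inj_row_free => u _; apply/rowP => -[].
- exact: polyhedron_vertex.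
Qed.

(** Dual feasibility for $c-\lambda v$ bounds every slope by [lam], so the new slope can replace it
    as multiplier. *)
Lemma shadow_pivot_slope lam B j l : feasible_basis B -> cone_condition v B ->
    dual_feasible (lpc L - lam *: v) B -> shadow_pivot v s B j l ->
  [/\ 0 < slope v B j, slope v B j <= lam, 0 < dot v (pivot_direction B j),
      dot (lpc L) (pivot_direction B j) =
        slope v B j * dot v (pivot_direction B j)
    & dual_feasible (lpc L - slope v B j *: v) (exchange B j l)].
Proof.
move=> [Bb _] Bc Bd [Ej [Bj ul _] _].
have [s0 vj cj Bs] := shadow_entering_dual Bb Bc Ej.
have := cj; rewrite dotBZl => /eqP; rewrite subr_eq0 => /eqP cE.
have slam : slope v B j <= lam.
  by have := Bd j Bj; rewrite dotBZl cE -mulrBl pmulr_lle0 // subr_le0.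
have Bd' := dual_feasible_exchange Bb Bj (lt0r_neq0 ul) cj Bs.
exact: (And5 s0 slam vj cE Bd').
Qed.

Lemma shadow_invariant_degenerate k B j l : shadow_invariant k B ->
  shadow_pivot v s B j l -> ~ Defs.nondegenerate B j ->
  shadow_invariant k (exchange B j l).
Proof.
move=> inv Sp nd; have Bc := shadow_invariant_cone inv.
have [Bf [lam [h [p [[lam0 Bd lamS] away pI pP pt]]]]] := inv.
have [_ Bp _] := Sp.
have [s0 slam vj cj Bd'] := shadow_pivot_slope Bf Bc Bd Sp.
split; first exact: feasible_exchange.
exists (slope v B j), h, p; rewrite vertex_degenerate //; split=> //.
split=> //; first exact: ltW.
by apply: le_lt_trans lamS; rewrite ler_wpM2r ?power_sum_ge0.
Qed.

Lemma shadow_invariant_nondegenerate k B j l : shadow_invariant k B ->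
  shadow_pivot v s B j l -> Defs.nondegenerate B j ->
  shadow_invariant k.+1 (exchange B j l).
Proof.
move=> inv Sp nd; have Bc := shadow_invariant_cone inv.
have [Bf [lam [h [p [[lam0 Bd lamS] away pI pP pt]]]]] := inv.
have [_ Bp _] := Sp; have r0 := (nondegenerate_ratio Bf Bp).1 nd.
have [s0 slam vj cj Bd'] := shadow_pivot_slope Bf Bc Bd Sp.
have B'f := feasible_exchange Bf Bp; split=> //.
have dE : vertex (exchange B j l) - vertex B =
    leaving_ratio B j l *: pivot_direction B j.
  by rewrite vertex_exchange // addrAC subrr add0r.
have [||H [xH yxH yxk S1 S2]] := @shadow_move _ _ _ _ L x0 (vertex B)
    (vertex (exchange B j l)) x001 (is01_vertex Bf) (is01_vertex B'f)
    (slope v B j) cint s0.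
- by rewrite dE dotZr mulr_gt0.
- by rewrite dE !dotZr cj mulrCA.
(* If [H.+1 < h], the earlier bound [lamS] contradicts [S1]. If [H.+1 = h], coordinate [H] has
   already left its value in [x0], contradicting [xH]. *)
have hH : (h <= H)%N.
  rewrite leqNgt; apply/negP => Hh; case: (ltngtP H.+1 h) => [Hh'|Hh'|Hh'].
  - have : slope v B j * power_sum L H.+1 <= lam * power_sum L h.-1.
      apply: ler_pM; rewrite ?power_sum_ge0 ?(ltW s0) // le_power_sum //.
      by rewrite -ltnS prednK // (leq_trans _ Hh').
    by move=> /(le_trans S1)/le_lt_trans/(_ lamS); rewrite ltxx.
  - by move: Hh; rewrite leqNgt Hh'.
  - by have := away _ Hh'; rewrite xH eqxx.
exists (slope v B j), H.+1, (append_point p (vertex (exchange B j l))).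
split=> [|i [iH]||i|i t Ht].
- by split=> //; apply: ltW.
- by move/ord_inj: iH => ->; rewrite -xH.
(* Coordinate [H] separates the new vertex: since [h <= H], all earlier points agree there with the
   current one. *)
- apply: (affinely_independent_append (t := H)) => // [i|]; rewrite pt ?pt //.
- rewrite /append_point; case: unlift => [i'|]; first exact: pP.
  exact: polyhedron_vertex.
- rewrite /append_point; case: unlift => [i'|] //.
  by rewrite pt ?yxk // (leq_trans hH) // ltnW.
Qed.

Lemma shadow_invariant_phase2 B1 k B : feasible_basis B1 ->
  cone_condition v B1 -> phase2 v s B1 k B -> shadow_invariant k B.
Proof.
move=> B1f B1c; elim=> {k B} [|k B j l _ inv Sp nd|k B j l _ inv Sp nd].
- exact: shadow_invariant_start.
- exact: shadow_invariant_degenerate.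
- exact: shadow_invariant_nondegenerate.
Qed.

Lemma shadow_step_exists B : feasible_basis B -> cone_condition v B ->
  ~ stops B -> exists B', shadow_step v s B B'.
Proof.
move=> Bf Bc /(shadow_entering_exists Bf.1 Bc)[j Ej]; have [[Bj cj] _] := Ej.
have [l Bp lexl] := lex_step_exists s P01.1 Bf Bj cj.
by exists (exchange B j l), j, l.
Qed.

Lemma lex_step_shadow B B' : shadow_step v s B B' -> lex_step s (lpc L) B B'.
Proof. by move=> [j [l [[[[_ cj] _] Bp lexl] ->]]]; exists j, l. Qed.

End Phase2.
End OrderedShadowRule.

Theorem theorem3 (R : realFieldType) (m n q : nat) (L : linprog R m n q)
    (Lint : integral L)
    (Afull : row_free (lpA L))
    (Dnonneg : has_nonneg_rows L)
    (P01 : zero_one_polytope (polyhedron L))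
    (B0 : basis L) (B0feas : feasible_basis B0) :
  let v := shadow_vector L (vertex B0) in
  (* Phase 1 can be carried out *)
  (exists B1 : basis L, phase1 v B0 B1) /\
  (* and, whatever its outcome and the subsequent choices, Phase 2 *)
  forall (B1 : basis L) (s : 'S_(ncols L)),
    phase1 v B0 B1 -> basis_first s B1 ->
    [/\ (* never gets stuck before the stopping criterion holds, *)
        forall (k : nat) (B : basis L), phase2 v s B1 k B -> ~ stops B ->
          exists B' : basis L, shadow_step v s B B',
        (* has no infinite run, *)
        ~ (exists f : nat -> basis L,
             f 0%N = B1 /\ forall t : nat, shadow_step v s (f t) (f t.+1)),
        (* stops only at optimal solutions, *)
        forall (k : nat) (B : basis L), phase2 v s B1 k B -> stops B ->
          optimal_solution L (vertex B)
      & (* and performs at most dim P non-degenerate pivots *)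
        forall (k : nat) (B : basis L), phase2 v s B1 k B ->
          (k <= affine_dim (polyhedron L))%N].
Proof.
move=> v; have Bx := is01_vertex Dnonneg P01 B0feas.
have [_ _ _ _ cint] := Lint.
split; first exact: phase1_exists.
move=> B1 s ph1 sB1; have B1f := feasible_phase1 B0feas ph1.
have B1c := cone_condition_phase1 ph1.
have inv := shadow_invariant_phase2 Dnonneg P01 Bx cint B1f B1c.
split=> [k B /inv kB|[f [f0 fS]]|k B /inv[Bf _] Bs|k B /inv[_ H]].
- by apply: shadow_step_exists => //;
  [case: kB | apply: shadow_invariant_cone kB].
(* Termination is measured by $c$ alone: entering directions have positive reduced cost for it. *)
- apply: (@no_infinite_lex_run _ _ _ _ L s (lpc L) f); rewrite ?f0 //.
    exact: lex_feasible_first.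
  by move=> t; apply: lex_step_shadow (fS t).
- split; first exact: polyhedron_vertex.
  by move=> y; apply: dual_feasible_optimal.
- by have [lam [h [p [_ _ pI pP _]]]] := H; apply: affine_dim_ge pI pP.
Qed.
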